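(* Let $p$ be a prime with $p \equiv 1 \pmod 4$. Then for every integer $n \geq \frac{p+1}{2}$, $$d\left(n+\tfrac{p-1}{2}\right) \equiv -2^{\frac{p-1}{2}}\, 3^2 7^2 \cdots (2p-3)^2 \, d(n) \pmod p,$$ where $3^2 7^2\cdots(2p-3)^2 = \prod_{i=1}^{(p-1)/2}(4i-1)^2$.
   Context: Define integer sequences as follows. Let $u(0)=1$ and for $n\ge 1$ $$u(n)=\prod_{j=1}^{n}(4j-1)^2-\sum_{m=0}^{n-1}\binom{2n+1}{2m+1}\left(\prod_{j=1}^{n-m}(4j-3)^2\right)u(m).$$ Let $v(0)=1$ and for $n\ge1$ $$v(n)=2^{n-1}\prod_{j=1}^{n}(4j-3)^2-\frac12\sum_{m=1}^{n-1}\binom{2n}{2m}v(m)v(n-m).$$ For integers $n,k\ge 0$ let $$s(n,k)=\frac{(2n)!}{(2k)!}\,[z^{2n}]\left(\sum_{j=0}^{\infty}\frac{u(j)}{(2j+1)!}z^{2j+1}\right)^{2k},$$ where $[z^{2n}]$ denotes the coefficient of $z^{2n}$. Finally define $d(n)$ recursively by $$d(n)=v(n)-\sum_{k=1}^{n-1}2^{n-k}s(n,k)d(k).$$ (These $d(n)$ are integers; they are the normalized Taylor coefficients of the Jacobi theta function $\theta_3$ at the point $x=1$.) *)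

(* Defs.v *)
From HB Require Import structures.
From mathcomp Require Import all_boot all_order all_algebra.

Set Implicit Arguments.
Unset Strict Implicit.
Unset Printing Implicit Defensive.

Import Order.TTheory GRing.Theory Num.Theory.
Local Open Scope ring_scope.

(* Course-of-values recursion: [F n f] computes the n-th term from a function
   [f] that agrees with the sequence below n (and is 0 from n on). *)
Definition cov_prefix (R : nmodType) (F : nat -> (nat -> R) -> R) (n : nat) :
    seq R :=
  iter n (fun l => rcons l (F (size l) (nth 0 l))) [::].

Definition cov_rec (R : nmodType) (F : nat -> (nat -> R) -> R) (n : nat) : R :=
  F n (nth 0 (cov_prefix F n)).

Lemma size_cov_prefix (R : nmodType) (F : nat -> (nat -> R) -> R) n :
  size (cov_prefix F n) = n.
Proof. by elim: n => //= n IHn; rewrite size_rcons IHn. Qed.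

Lemma nth_cov_prefix (R : nmodType) (F : nat -> (nat -> R) -> R) n i :
  (i < n)%N -> nth 0 (cov_prefix F n) i = cov_rec F i.
Proof.
elim: n => // n IHn; rewrite ltnS leq_eqVlt /= nth_rcons size_cov_prefix.
by case/orP=> [/eqP-> | lt_in]; rewrite ?ltnn ?eqxx // lt_in IHn.
Qed.

Lemma cov_recE (R : nmodType) (F : nat -> (nat -> R) -> R) :
  (forall n f g, (forall i, (i < n)%N -> f i = g i) -> F n f = F n g) ->
  forall n, cov_rec F n = F n (cov_rec F).
Proof. by move=> extF n; apply: extF => i; apply: nth_cov_prefix. Qed.

Definition u_step (n : nat) (u : nat -> int) : int :=
  if n == 0 then 1 else
  \prod_(1 <= j < n.+1) (4 * j%:R - 1) ^+ 2
  - \sum_(0 <= m < n) 'C(2 * n + 1, 2 * m + 1)%:R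
      * (\prod_(1 <= j < (n - m).+1) (4 * j%:R - 3) ^+ 2) * u m.

Definition u : nat -> int := cov_rec u_step.

Definition v_step (n : nat) (v : nat -> rat) : rat :=
  if n == 0 then 1 else
  2 ^+ n.-1 * \prod_(1 <= j < n.+1) (4 * j%:R - 3) ^+ 2
  - 2^-1 * \sum_(1 <= m < n) 'C(2 * n, 2 * m)%:R * v m * v (n - m)%N.

Definition v : nat -> rat := cov_rec v_step.

(* Formal power series over a ring, as sequences of coefficients. *)
Definition fps_one (R : pzSemiRingType) : nat -> R := fun n => (n == 0)%:R.

Definition fps_mul (R : pzSemiRingType) (f g : nat -> R) : nat -> R :=
  fun n => \sum_(i < n.+1) f i * g (n - i)%N.

Definition fps_exp (R : pzSemiRingType) (f : nat -> R) (k : nat) : nat -> R :=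
  iter k (fps_mul f) (fps_one R).

(* \sum_j u(j) / (2j+1)! z^(2j+1): for i = 2j+1, [i./2] is j. *)
Definition u_series : nat -> rat :=
  fun i => if odd i then (u i./2)%:~R / (i`!)%:R else 0.

Definition s (n k : nat) : rat :=
  ((2 * n)`!)%:R / ((2 * k)`!)%:R * fps_exp u_series (2 * k) (2 * n).

Definition d_step (n : nat) (d : nat -> rat) : rat :=
  v n - \sum_(1 <= k < n) 2 ^+ (n - k) * s n k * d k.

Definition d : nat -> rat := cov_rec d_step.

Lemma u0 : u 0 = 1.
Proof. by []. Qed.

Lemma uE n : (0 < n)%N ->
  u n = \prod_(1 <= j < n.+1) (4 * j%:R - 1) ^+ 2
        - \sum_(0 <= m < n) 'C(2 * n + 1, 2 * m + 1)%:R
            * (\prod_(1 <= j < (n - m).+1) (4 * j%:R - 3) ^+ 2) * u m.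
Proof.
move=> n_gt0; rewrite /u cov_recE => [|k f g eq_fg].
  by rewrite {1}/u_step eqn0Ngt n_gt0.
rewrite /u_step; case: ifP => // _; congr (_ - _).
by apply: eq_big_nat => m /andP[_ /eq_fg->].
Qed.

Lemma v0 : v 0 = 1.
Proof. by []. Qed.

Lemma vE n : (0 < n)%N ->
  v n = 2 ^+ n.-1 * \prod_(1 <= j < n.+1) (4 * j%:R - 3) ^+ 2
        - 2^-1 * \sum_(1 <= m < n) 'C(2 * n, 2 * m)%:R * v m * v (n - m)%N.
Proof.
move=> n_gt0; rewrite /v cov_recE => [|k f g eq_fg].
  by rewrite {1}/v_step eqn0Ngt n_gt0.
rewrite /v_step; case: ifP => // _; congr (_ - _ * _).
apply: eq_big_nat => m /andP[m_gt0 lt_mk].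
by rewrite !eq_fg // ltn_subrL m_gt0 (leq_ltn_trans _ lt_mk).
Qed.

Lemma dE n : d n = v n - \sum_(1 <= k < n) 2 ^+ (n - k) * s n k * d k.
Proof.
rewrite /d cov_recE // => k f g eq_fg; congr (_ - _).
by apply: eq_big_nat => m /andP[_ /eq_fg->].
Qed.

(* Main.v *)
Require Import Defs.
From mathcomp Require Import all_boot all_order all_algebra.
From mathcomp Require Import ring zify.
Import Order.TTheory GRing.Theory Num.Theory.
Local Open Scope ring_scope.

(* Work with divided power (Hurwitz) series over F_p, where the index shift is
   the derivation d/dz and hence the p-fold shift f -> f^(p) is a derivation too.  Put
   A = \sum_n 1^2 5^2 ... (4n-3)^2 z^(2n)/(2n)!, similarly B with the factors
   4j-1 and odd exponents.  The recursions say that U A = B for the series U of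
   the u(n), and that the series of the v(n)/2^n is a square root V of A.
   Modulo p = 4k+1 one has A^(p) = 0 (as p is one of the factors 4j-3) and
   B^(p) = b A with b = 3^2 7^2 ... (2p-3)^2, so U^(p) = b and V^(p) = 0.
   Induction on m then gives (U^m/m!)^(p) = b U^(m-1)/(m-1)! + U^(m-p)/(m-p)!.
   The numbers e_(2k) = d(k)/2^k are the coefficients of V in the basis U^m/m!,
   so V^(p) = 0 reads b e_(j+1) + e_(j+p) = 0; take j + 1 = 2n. *)

(** * Hurwitz products and their Leibniz rule *)

(** Pascal's rule. The summand [F] is arbitrary so that it covers both [hmulS] and, with whole
    products as summands, [hmul_leibniz]. *)
Lemma sum_pascal (V : nmodType) (F : nat -> nat -> V) n :
  \sum_(i < n.+2) F i (n.+1 - i)%N *+ 'C(n.+1, i) =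
  \sum_(i < n.+1) F i.+1 (n - i)%N *+ 'C(n, i) +
  \sum_(i < n.+1) F i (n - i).+1 *+ 'C(n, i).
Proof.
rewrite big_ord_recl bin0 subn0.
under eq_bigr => i _ do rewrite lift0 subSS binS addnC mulrnDr.
rewrite big_split /= addrCA; congr (_ + _).
rewrite [RHS]big_ord_recl bin0 subn0 big_ord_recr /= bin_small // mulr0n addr0.
by congr (_ + _); apply: eq_bigr => i _; rewrite /bump /= add1n subnSK.
Qed.

(** The product of exponential generating series with coefficients [f n] and [g n] over n!, written
    without division so that it makes sense modulo p. *)
Definition hmul {R : pzSemiRingType} (f g : nat -> R) (n : nat) : R :=
  \sum_(i < n.+1) f i * g (n - i)%N *+ 'C(n, i).

Section HurwitzProduct.
Variable R : comPzSemiRingType.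
Implicit Types f g h : nat -> R.

Lemma hmul0 f g : hmul f g 0 = f 0%N * g 0%N.
Proof. by rewrite /hmul big_ord1 bin0. Qed.

Lemma hmulS f g n :
  hmul f g n.+1 = hmul (fun i => f i.+1) g n + hmul f (fun i => g i.+1) n.
Proof. by rewrite /hmul (sum_pascal _ (fun i j => f i * g j)). Qed.

Lemma eq_hmulr f g h n : g =1 h -> hmul f g n = hmul f h n.
Proof. by move=> gh; apply: eq_bigr => i _; rewrite gh. Qed.

Lemma eq_hmull f g h n : g =1 h -> hmul g f n = hmul h f n.
Proof. by move=> gh; apply: eq_bigr => i _; rewrite gh. Qed.

Lemma hmulDr f g h n :
  hmul f (fun i => g i + h i) n = hmul f g n + hmul f h n.
Proof.
by rewrite -big_split; apply: eq_bigr => i _; rewrite mulrDr mulrnDl.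
Qed.

Lemma hmulZr c f g n : hmul f (fun i => c * g i) n = c * hmul f g n.
Proof. by rewrite mulr_sumr; apply: eq_bigr => i _; rewrite mulrCA mulrnAr. Qed.

Lemma hmulf0 f n : hmul f (fun=> 0) n = 0.
Proof. by apply: big1 => i _; rewrite mulr0 mul0rn. Qed.

Lemma hmul0f f n : hmul (fun=> 0) f n = 0.
Proof. by apply: big1 => i _; rewrite mul0r mul0rn. Qed.

Lemma hmul1f f n : hmul (fun i => (i == 0)%:R) f n = f n.
Proof.
rewrite /hmul big_ord_recl big1 => [|i _]; last by rewrite mul0r mul0rn.
by rewrite subn0 bin0 mul1r addr0.
Qed.

Lemma hmulC f g n : hmul f g n = hmul g f n.
Proof.
elim: n f g => [|n IHn] f g; first by rewrite !hmul0 mulrC.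
by rewrite !hmulS addrC; congr (_ + _); apply: IHn.
Qed.

Lemma hmulCA f g h n : hmul f (hmul g h) n = hmul g (hmul f h) n.
Proof.
elim: n f g h => [|n IHn] f g h; first by rewrite !hmul0 mulrCA.
rewrite !hmulS (eq_hmulr _ _ _ _ (hmulS g h)) (eq_hmulr _ _ _ _ (hmulS f h)).
by rewrite !hmulDr !(IHn f) (IHn (fun i => f i.+1)) addrCA.
Qed.

Lemma hmul_leibniz f g n N :
  hmul f g (n + N) =
  \sum_(j < N.+1) hmul (fun i => f (i + j)%N) (fun i => g (i + (N - j))%N) n
    *+ 'C(N, j).
Proof.
elim: N f g => [|N IHN] f g.
  rewrite big_ord1 bin0 mulr1n addn0 /hmul.
  by apply: eq_bigr => i _; rewrite !addn0.
rewrite addnS hmulS !IHN.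
rewrite (sum_pascal _
  (fun j k => hmul (fun i => f (i + j)%N) (fun i => g (i + k)%N) n)).
congr (_ + _); apply: eq_bigr => j _; congr (_ *+ _).
  by apply: eq_hmull => i; rewrite addnS.
by apply: eq_hmulr => i; rewrite addnS.
Qed.

End HurwitzProduct.

(* The p-th power of a derivation is a derivation in characteristic p. *)
Lemma hmul_shift_pchar (R : comNzSemiRingType) p (f g : nat -> R) n :
  p \in [pchar R] ->
  hmul f g (n + p) =
  hmul (fun i => f (i + p)%N) g n + hmul f (fun i => g (i + p)%N) n.
Proof.
move=> pR; have p_pr := pcharf_prime pR.
case: p p_pr pR => // p p_pr pR.
rewrite hmul_leibniz big_ord_recl big_ord_recr big1 => [|i _]; last first.
  rewrite !lift0 -mulr_natr.
  suff /dvdnP[k ->]: (p.+1 %| 'C(p.+1, i.+1))%N.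
    by rewrite natrM (pcharf0 pR) !mulr0.
  by apply: prime_dvd_bin => //=; rewrite ltnS ltn_ord.
rewrite lift0 binn bin0 subn0 subnn !mulr1n [X in _ + X]add0r addrC.
congr (_ + _).
  by apply: eq_hmulr => i; rewrite addn0.
by apply: eq_hmull => i; rewrite addn0.
Qed.

(** Coefficient n of the product is [g n] plus multiples of earlier coefficients of [g]. Serves to
    cancel A and V. *)
Lemma hmul_unitl_eq0 (R : comPzSemiRingType) (f g : nat -> R) :
  f 0%N = 1 -> hmul f g =1 (fun=> 0) -> g =1 (fun=> 0).
Proof.
move=> f0 fg0; elim/ltn_ind => n IHn.
rewrite -[RHS](fg0 n) /hmul big_ord_recl big1 => [|i _].
  by rewrite f0 bin0 subn0 mul1r addr0.
by rewrite IHn ?mulr0 ?mul0rn // lift0; have := ltn_ord i; lia.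
Qed.

(* The divided powers f^m / m! of a series f without constant term, obtained
   by integrating (f^(m+1) / (m+1)!)' = f' * f^m / m!, so that no division is
   needed. *)
Fixpoint dpow {R : pzSemiRingType} (f : nat -> R) (m : nat) : nat -> R :=
  if m is m'.+1 then
    fun n => if n is n'.+1 then hmul (fun i => f i.+1) (dpow f m') n' else 0
  else fun n => (n == 0)%:R.

(** * Divided powers and their p-fold shift *)

Section DividedPowers.
Variable R : comPzSemiRingType.
Variable f : nat -> R.

Lemma dpow_small m n : (n < m)%N -> dpow f m n = 0.
Proof.
elim: m n => [|m IHm] [|n] //=; rewrite ltnS => lt_nm.
apply: big1 => i _; rewrite IHm ?mulr0 ?mul0rn //.
by apply: leq_ltn_trans lt_nm; apply: leq_subr.
Qed.

Lemma dpow_diag n : f 1%N = 1 -> dpow f n n = 1.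
Proof.
move=> f1; elim: n => //= n IHn; rewrite /hmul big_ord_recl big1 => [|i _].
  by rewrite f1 subn0 IHn bin0 mulr1 addr0.
rewrite dpow_small ?mulr0 ?mul0rn // lift0.
by case: n i {IHn} => [[]|n i] //; lia.
Qed.

Lemma dpow1 n : f 0%N = 0 -> dpow f 1 n = f n.
Proof.
by move=> f0; case: n => [|n] //=; rewrite hmulC hmul1f.
Qed.

Lemma dpow_parity m n : (forall i, ~~ odd i -> f i = 0) -> odd (m + n) ->
  dpow f m n = 0.
Proof.
move=> f_odd; elim: m n => [|m IHm] [|n] //=; rewrite addnS /= negbK => odd_mn.
apply: big1 => i _; case odd_i: (odd i).
  by rewrite f_odd ?mul0r ?mul0rn //= odd_i.
rewrite IHm ?mulr0 ?mul0rn // oddD oddB; last by rewrite -ltnS.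
by rewrite odd_i addbF -oddD.
Qed.

(** Ties [dpow] to actual powers: by the product rule and induction on [m], both sides have the
    derivative (m+1) f' f^m/m!. *)
Lemma hmul_dpow m n : f 0%N = 0 ->
  hmul f (dpow f m) n = dpow f m.+1 n *+ m.+1.
Proof.
move=> f0; elim: m n => [|m IHm] [|n].
- by rewrite hmul0 f0 mul0r.
- by rewrite hmulC hmul1f dpow1.
- by rewrite hmul0 f0 mul0r mul0rn.
rewrite hmulS [hmul f _ n](hmulCA _ f) (eq_hmulr _ _ _ _ _ IHm).
rewrite -[dpow f m.+2 n.+1]/(hmul (fun i => f i.+1) (dpow f m.+1) n) mulrS.
congr (_ + _); rewrite -mulr_natl -hmulZr; apply: eq_hmulr => i.
by rewrite mulr_natl.
Qed.

End DividedPowers.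

(** Let D be the p-fold shift, a derivation commuting with d/dz. As D f = b is constant, D f' = 0,
    so D(f^(m+1)/(m+1)!) has derivative f' D(f^m/m!). Integrating inductively gives the first term;
    the second comes from the constant of integration at exponent p. *)
Lemma dpow_shift_pchar (R : fieldType) p (f : nat -> R) b m n :
  p \in [pchar R] -> f 0%N = 0 -> f 1%N = 1 ->
  (forall n, f (n + p)%N = b * (n == 0)%:R) ->
  dpow f m (n + p) =
  (if m is m'.+1 then b * dpow f m' n else 0)
  + (if (p <= m)%N then dpow f (m - p) n else 0).
Proof.
move=> pR f0 f1 fp; have p_pr := pcharf_prime pR; have p_gt1 := prime_gt1 p_pr.
elim: m n => [|m IHm] [|n].
- by rewrite /= leqNgt prime_gt0 //= gtn_eqF ?addr0 ?prime_gt0.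
- by rewrite /= leqNgt prime_gt0 //= addr0.
(* The constant of integration is the coefficient at [p]: b for exponent 1, 1 for exponent p, and 0
   otherwise. *)
- have -> : dpow f m.+1 (0 + p) = b * (m == 0)%:R + (m.+1 == p)%:R.
    rewrite add0n; case: (ltngtP m.+1 p) => [lt_mp|gt_mp|def_p].
    + case: m {IHm} lt_mp => [|m] lt_mp.
        by rewrite dpow1 // -[p]add0n fp addr0.
      rewrite mulr0 addr0; apply/eqP.
      (* Exponents from 2 to p-1 are invertible, so it suffices that [f] times the preceding divided
         power has coefficient 0 at [p]. *)
      have m_unit : m.+2%:R != 0 :> R.
        by rewrite -(dvdn_pcharf pR) gtnNdvd.
      rewrite -(mulIr_eq0 _ (mulIf m_unit)) mulr_natr -hmul_dpow //.
      by rewrite -[p]add0n hmul_shift_pchar // !hmul0 f0 mul0r addr0 mulr0.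
    + rewrite dpow_small // gtn_eqF ?mulr0 ?addr0 //.
      by rewrite -ltnS (ltn_trans p_gt1).
    + rewrite -def_p dpow_diag // gtn_eqF ?mulr0 ?add0r //.
      by rewrite -ltnS def_p.
  congr (_ + _); first by case: (m).
  case: leqP => [le_pm|lt_mp]; last by rewrite ltn_eqF.
  case: (eqVneq m.+1 p) => [->|ne_mp]; first by rewrite subnn.
  by rewrite dpow_small // subn_gt0 ltn_neqAle eq_sym ne_mp.
rewrite addSn [LHS]/= hmul_shift_pchar //.
rewrite (eq_hmull _ _ _ (fun=> 0)) => [|i]; last by rewrite -addSn fp mulr0.
rewrite hmul0f add0r (eq_hmulr _ _ _ _ _ IHm) hmulDr; congr (_ + _).
  by case: m {IHm} => [|m]; rewrite ?hmulf0 ?mulr0 // hmulZr.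
case: (leqP p m) => [le_pm|lt_mp]; first by rewrite leqW // subSn.
rewrite hmulf0; case: leqP => // le_pm.
by have -> : (m.+1 - p = 0)%N by lia.
Qed.

(* Comparing the coefficients of the divided powers of f in the p-th derivative
   of F = \sum_m e m * dpow f m. *)
Lemma dpow_sum_shift_pchar (R : fieldType) p (f e F : nat -> R) b :
  p \in [pchar R] -> f 0%N = 0 -> f 1%N = 1 ->
  (forall n, f (n + p)%N = b * (n == 0)%:R) ->
  (forall n, F n = \sum_(m < n.+1) e m * dpow f m n) ->
  (forall n, F (n + p)%N = 0) ->
  forall n, e (n + p)%N = - b * e n.+1.
Proof.
move=> pR f0 f1 fp FE Fp n; have p_gt0 := prime_gt0 (pcharf_prime pR).
suff: b * e n.+1 + e (n + p)%N = 0.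
  by rewrite mulNr addrC => /eqP; rewrite addr_eq0 => /eqP.
(* Coefficient n of the shifted expansion is the sum over i <= n of (b e(i+1) + e(i+p))
   [dpow f i n]. Brackets with i < n vanish by induction, and [dpow f n n] is 1. *)
elim/ltn_ind: n => n IHn.
have /esym := Fp n; rewrite FE.
under eq_bigr => m _ do rewrite (dpow_shift_pchar _ p f b) // mulrDr.
rewrite big_split /= big_ord_recl mulr0 add0r.
have -> : \sum_(i < n + p) e (lift ord0 i) * (b * dpow f i n) =
          \sum_(i < n.+1) b * e i.+1 * dpow f i n.
  rewrite (big_ord_widen (n + p)%N (fun i => b * e i.+1 * dpow f i n));
    last by lia.
  rewrite [RHS]big_mkcond; apply: eq_bigr => i _; rewrite lift0.
  case: ltnP => [_|lt_ni]; first by rewrite mulrCA mulrA.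
  by rewrite dpow_small // !mulr0.
have -> : \sum_(i < (n + p).+1)
            e i * (if (p <= i)%N then dpow f (i - p) n else 0)
          = \sum_(i < n.+1) e (i + p)%N * dpow f i n.
  rewrite -addSn addnC big_split_ord /= big1 ?add0r => [|i _].
    by apply: eq_bigr => i _; rewrite leq_addr addKn addnC.
  by rewrite leqNgt ltn_ord mulr0.
rewrite -big_split /= big_ord_recr big1 => [|i _] /=.
  by rewrite add0r dpow_diag // !mulr1.
by rewrite -mulrDl IHn // mul0r.
Qed.

(** * Even and odd series *)

Definition evens {R : nmodType} (a : nat -> R) (i : nat) : R :=
  if odd i then 0 else a i./2.

Definition odds {R : nmodType} (a : nat -> R) (i : nat) : R :=
  if odd i then a i./2 else 0.

Lemma evens_double (R : nmodType) (a : nat -> R) n : evens a n.*2 = a n.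
Proof. by rewrite /evens odd_double doubleK. Qed.

Lemma evens_doubleS (R : nmodType) (a : nat -> R) n : evens a n.*2.+1 = 0.
Proof. by rewrite /evens /= odd_double. Qed.

Lemma odds_double (R : nmodType) (a : nat -> R) n : odds a n.*2 = 0.
Proof. by rewrite /odds odd_double. Qed.

Lemma odds_doubleS (R : nmodType) (a : nat -> R) n : odds a n.*2.+1 = a n.
Proof. by rewrite /odds /= odd_double /= uphalf_double. Qed.

Lemma sum_ord_double (V : nmodType) (F : nat -> V) n :
  \sum_(i < n.*2) F i = \sum_(i < n) F i.*2 + \sum_(i < n) F i.*2.+1.
Proof.
elim: n => [|n IHn]; first by rewrite !big_ord0 addr0.
by rewrite doubleS !big_ord_recr /= IHn addrACA addrA.
Qed.

Lemma sum_ord_doubleS (V : nmodType) (F : nat -> V) n :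
  \sum_(i < n.*2.+1) F i = \sum_(i < n.+1) F i.*2 + \sum_(i < n) F i.*2.+1.
Proof. by rewrite [in RHS]big_ord_recr big_ord_recr sum_ord_double addrAC. Qed.

Section ParityProduct.
Variable R : comPzSemiRingType.
Implicit Types a b : nat -> R.

Lemma hmul_evens a b :
  hmul (evens a) (evens b) =1
  evens (fun n => \sum_(m < n.+1) a m * b (n - m)%N *+ 'C(n.*2, m.*2)).
Proof.
move=> i; rewrite -[i]odd_double_half; move: i./2 (odd i) => n [].
  rewrite add1n evens_doubleS; apply: big1 => j _.
  rewrite /evens; case: ifP => odd_j; first by rewrite mul0r mul0rn.
  by rewrite oddB ?odd_j /= ?odd_double ?mulr0 ?mul0rn // -ltnS.
rewrite add0n evens_double /hmul.
rewrite (sum_ord_doubleS _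
  (fun i => evens a i * evens b (n.*2 - i)%N *+ 'C(n.*2, i))).
rewrite [X in _ + X]big1 => [|m _]; last by rewrite evens_doubleS mul0r mul0rn.
by rewrite addr0; apply: eq_bigr => m _; rewrite -doubleB !evens_double.
Qed.

Lemma hmul_odds_evens a b :
  hmul (odds a) (evens b) =1
  odds (fun n => \sum_(m < n.+1) a m * b (n - m)%N *+ 'C(n.*2.+1, m.*2.+1)).
Proof.
move=> i; rewrite -[i]odd_double_half; move: i./2 (odd i) => n []; last first.
  rewrite add0n odds_double; apply: big1 => j _.
  rewrite /odds; case: ifP => odd_j; last by rewrite mul0r mul0rn.
  by rewrite /evens oddB ?odd_j ?odd_double ?mulr0 ?mul0rn // -ltnS.
rewrite add1n odds_doubleS /hmul -doubleS.
rewrite (sum_ord_double _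
  (fun i => odds a i * evens b (n.*2.+1 - i)%N *+ 'C(n.*2.+1, i))).
rewrite big1 => [|m _]; last by rewrite odds_double mul0r mul0rn.
rewrite add0r; apply: eq_bigr => m _.
by rewrite odds_doubleS subSS -doubleB evens_double.
Qed.

End ParityProduct.

(** * Change of coefficient ring and comparison with ordinary power series *)

Lemma hmul_rmorph (R S : pzSemiRingType) (h : {rmorphism R -> S})
    (f g : nat -> R) n :
  hmul (fun i => h (f i)) (fun i => h (g i)) n = h (hmul f g n).
Proof.
by rewrite rmorph_sum; apply: eq_bigr => i _; rewrite rmorphMn rmorphM.
Qed.

Lemma dpow_rmorph (R S : comPzSemiRingType) (h : {rmorphism R -> S})
    (f : nat -> R) m n :
  dpow (fun i => h (f i)) m n = h (dpow f m n).
Proof.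
elim: m n => [|m IHm] [|n] //=; rewrite ?rmorph1 ?rmorph0 //.
by rewrite (eq_hmulr _ _ _ _ _ IHm) (hmul_rmorph _ _ h).
Qed.

Lemma eq_dpow (R : comPzSemiRingType) (f g : nat -> R) m :
  f =1 g -> dpow f m =1 dpow g m.
Proof.
move=> fg; elim: m => [|m IHm] [|n] //=.
by rewrite (eq_hmulr _ _ _ _ _ IHm); apply: eq_hmull.
Qed.

Lemma hmul_fps_mul (f g : nat -> rat) n :
  hmul (fun i => i`!%:R * f i) (fun i => i`!%:R * g i) n =
  n`!%:R * fps_mul f g n.
Proof.
rewrite /fps_mul mulr_sumr; apply: eq_bigr => i _.
have le_in : (i <= n)%N by rewrite -ltnS.
by rewrite -(bin_fact le_in) !natrM -mulr_natl; ring.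
Qed.

Lemma dpow_fps_exp (f : nat -> rat) m n : f 0%N = 0 ->
  dpow (fun i => i`!%:R * f i) m n = n`!%:R / m`!%:R * fps_exp f m n.
Proof.
move=> f0; have fact_neq0 k : k`!%:R != 0 :> rat.
  by rewrite pnatr_eq0 -lt0n fact_gt0.
elim: m n => [|m IHm] n.
  by rewrite /= /fps_one; case: n => [|n]; rewrite ?divr1 ?mulr1 ?mulr0.
have mS_neq0 : m.+1%:R != 0 :> rat by rewrite pnatr_eq0.
apply: (mulIf mS_neq0); rewrite mulr_natr -hmul_dpow ?f0 ?mulr0 //.
have IH' i : dpow (fun i => i`!%:R * f i) m i =
           (m`!%:R)^-1 * (i`!%:R * fps_exp f m i).
  by rewrite IHm; ring.
rewrite (eq_hmulr _ _ _ _ _ IH') hmulZr hmul_fps_mul factS natrM invfM.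
rewrite -[fps_exp f m.+1 n]/(fps_mul f (fps_exp f m) n).
by field; rewrite fact_neq0 nat1r.
Qed.

(** The divided power is computed over the integers, which makes [s n k] integral and ready for
    reduction modulo p. *)
Lemma sE n k : s n k = (dpow (odds u) k.*2 n.*2)%:~R.
Proof.
rewrite /s !mul2n -dpow_fps_exp // -dpow_rmorph; apply: eq_dpow => i.
rewrite /u_series /odds; case: ifP => _; last by rewrite mulr0.
by rewrite mulrC divfK // pnatr_eq0 -lt0n fact_gt0.
Qed.

(** The recursion for [d] solved for [v]: the term k = n is [d n], and the added term k = 0 vanishes
    unless n = 0. *)
Lemma vE_sum n :
  v n = \sum_(k < n.+1) 2 ^+ (n - k) * (dpow (odds u) k.*2 n.*2)%:~R * d k.
Proof.
rewrite big_ord_recr /= subnn expr0 mul1r dpow_diag // mul1r.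
case: n => [|n]; first by rewrite big_ord0 add0r dE big_geq // subr0.
rewrite [in RHS]dE addrC -addrA [X in _ + X](_ : _ = 0) ?addr0 //.
rewrite big_add1 big_mkord big_ord_recl /= mulr0 mul0r add0r addrC.
apply/eqP; rewrite subr_eq0; apply/eqP; apply: eq_bigr => i _.
by rewrite /bump /= add1n sE.
Qed.

(** * Integrality of [v] and [d] *)

(** Terms pair off under i -> n-1-i; only a middle term stays alone. This absorbs the factor 1/2 in
    the recursion for [v]. *)
Lemma dvdz2_sum_symm n (F : nat -> int) :
  (forall i, (i < n)%N -> F (n.-1 - i)%N = F i) ->
  (forall i, n = i.*2.+1 -> (2 %| F i)%Z) ->
  (2 %| \sum_(i < n) F i)%Z.
Proof.
elim/ltn_ind: n F => -[|[|n]] IHn F F_symm F_mid.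
- by rewrite big_ord0.
- by rewrite big_ord1 F_mid.
rewrite big_ord_recl big_ord_recr /=.
have -> : F n.+1 = F 0%N by rewrite -[RHS]F_symm // subn0.
rewrite addrCA -mulr2n -[F 0%N *+ 2]mulr_natr.
suff /dvdzP[q ->]: (2 %| \sum_(i < n) F (bump 0 i))%Z.
  by rewrite -mulrDl dvdz_mull.
under eq_bigr => i _ do rewrite /bump /= add1n.
apply: (IHn n _ (fun i => F i.+1)) => [|i lt_in|i def_n] //.
  by rewrite -[RHS]F_symm; first congr (F _); lia.
by rewrite F_mid // def_n.
Qed.

Lemma v_int n : v n \is a Num.int.
Proof.
elim/ltn_ind: n => -[|n] IHn; first by rewrite v0 rpred1.
rewrite vE // rpredB //.
  rewrite rpredM ?rpredX ?rpred_nat ?rpred_prod // => j _.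
  by rewrite rpredX // rpredB ?rpredM ?rpred_nat.
pose F m := (numq (v m.+1) * numq (v (n - m)%N)) *+ 'C(n.+1.*2, m.+1.*2).
have -> : \sum_(1 <= m < n.+1) 'C(2 * n.+1, 2 * m)%:R * v m * v (n.+1 - m)%N =
          (\sum_(m < n) F m)%:~R.
  rewrite big_add1 big_mkord rmorph_sum; apply: eq_bigr => m _.
  have lt_mn := ltn_ord m.
  rewrite /= -mulrA mulr_natl rmorphMn rmorphM /= !numqK ?IHn ?mul2n //; lia.
suff /dvdzP[q ->] : (2 %| \sum_(m < n) F m)%Z.
  by rewrite rmorphM /= mulrC mulfK // intr_int.
apply: dvdz2_sum_symm => [i lt_in|i def_n].
  rewrite /F mulrC; congr (numq (v _) * numq (v _) *+ _); try lia.
  rewrite -bin_sub ?leq_double; last by lia.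
  by congr 'C(_, _); lia.
rewrite /F -mulr_natr dvdz_mull //.
(* The middle term carries a central binomial coefficient, which Pascal's rule and symmetry write as
   2 C(2n+1, n+1). *)
have -> : (i.+1.*2 = n.+1)%N by lia.
rewrite doubleS binS -[in X in (_ + X)%N]bin_sub; last by lia.
have -> : (n.*2.+1 - n = n.+1)%N by lia.
by rewrite addnn -mul2n natrM dvdz_mulr.
Qed.

Lemma d_int n : d n \is a Num.int.
Proof.
elim/ltn_ind: n => n IHn; rewrite dE rpredB ?v_int // big_nat rpred_sum // => k.
case/andP=> _ lt_kn; rewrite sE.
by rewrite !rpredM ?IHn ?rpredX ?rpred_nat ?intr_int.
Qed.

(** * The recursions as product identities, and their reduction modulo p *)

Definition sqprod (c : int) (n : nat) : int :=
  \prod_(1 <= j < n.+1) (4 * j%:R - c) ^+ 2.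

Lemma sqprodS c n : sqprod c n.+1 = sqprod c n * (4 * n.+1%:R - c) ^+ 2.
Proof. by rewrite /sqprod big_nat_recr. Qed.

Lemma hmul_u_sqprod :
  hmul (odds u) (evens (sqprod 3)) =1 odds (sqprod 1).
Proof.
move=> i; rewrite hmul_odds_evens /odds; case: ifP => // _; move: i./2 => {i} n.
rewrite big_ord_recr /= subnn binn mulr1n {2}/sqprod big_geq // mulr1.
case: n => [|n]; first by rewrite big_ord0 add0r u0 /sqprod big_geq.
rewrite uE // addrCA -[RHS]addr0; congr (_ + _); apply/eqP.
rewrite subr_eq0 big_mkord; apply/eqP; apply: eq_bigr => m _.
by rewrite -mulrA mulr_natl !addn1 !mul2n mulrC.
Qed.

(** For n > 0 the two end terms of the square are both [v n], so this is twice the recursion for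
    [v]. *)
Lemma hmul_v_sqprod :
  hmul (evens (numq \o v)) (evens (numq \o v)) =1
  evens (fun n => 2 ^+ n * sqprod 3 n).
Proof.
move=> i; rewrite hmul_evens /evens; case: ifP => // _; move: i./2 => {i} n.
apply: (@intr_inj rat); rewrite rmorph_sum /=.
under eq_bigr => m _ do
  rewrite rmorphMn rmorphM /= !numqK ?v_int // -mulr_natl mulrA.
case: n => [|n]; first by rewrite big_ord1 v0 /sqprod big_geq.
rewrite big_ord_recl big_ord_recr /= /bump /= subn0 subnn add1n bin0 binn v0.
rewrite !mul1r mulr1 (vE (ltn0Sn n)).
set S := (X in _ - _ * X).
rewrite (_ : \sum_(i < n) _ = S); last first.
  rewrite /S big_add1 big_mkord; apply: eq_bigr => m _.
  by rewrite /bump /= !add1n !mul2n.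
rewrite rmorphM rmorphXn rmorph_nat exprS rmorph_prod.
under [in RHS]eq_bigr => j _ do
  rewrite rmorphXn rmorphB rmorphM !rmorph_nat.
by field.
Qed.

Lemma numq_vE_sum n :
  numq (v n) =
  \sum_(k < n.+1) 2 ^+ (n - k) * dpow (odds u) k.*2 n.*2 * numq (d k).
Proof.
apply: (@intr_inj rat); rewrite numqK ?v_int // vE_sum rmorph_sum.
apply: eq_bigr => k _.
by rewrite [in RHS]rmorphM [in RHS]rmorphM rmorphXn rmorph_nat /= numqK ?d_int.
Qed.

(** With j = n + 1 + (p-1)/2, the factor 4j - 1 equals 4(n+1) - 3 + 2p. *)
Lemma sqprod_shift_pchar (p : nat) (R : nzRingType) n : p \in [pchar R] ->
  (p = 1 %[mod 4])%N ->
  (sqprod 1 (n + p./2))%:~R = (sqprod 1 p./2)%:~R * (sqprod 3 n)%:~R :> R.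
Proof.
move=> pR p_mod4; elim: n => [|n IHn].
  by rewrite /sqprod [in X in _ * X]big_geq // mulr1.
rewrite addSn !sqprodS [in LHS]rmorphM [in RHS]rmorphM /= IHn -!mulrA.
congr (_ * (_ * _)).
rewrite !rmorphXn /=; congr (_ ^+ _).
have -> : 4 * (n + p./2).+1%:R - 1 = 4 * n.+1%:R - 3 + p%:R *+ 2 :> int by lia.
by rewrite rmorphD rmorphMn rmorph_nat /= (pcharf0 pR) mul0rn addr0.
Qed.

(** For p = 4k+1 the factor with j = k+1 is p itself. *)
Lemma sqprod3_pchar (p : nat) (R : nzRingType) n : p \in [pchar R] ->
  (p = 1 %[mod 4])%N -> (p < n.*2)%N -> (sqprod 3 n)%:~R = 0 :> R.
Proof.
move=> pR p_mod4 lt_pn.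
have [k def_p] : exists k, p = (4 * k + 1)%N by exists (p %/ 4)%N; lia.
rewrite /sqprod (big_cat_nat (n := k.+1)) /=; [|lia|lia].
rewrite [X in _ * X]big_ltn; last by lia.
have -> : 4 * k.+1%:R - 3 = p%:R :> int by lia.
rewrite rmorphM rmorphM rmorphXn rmorph_nat /= (pcharf0 pR) expr0n.
by rewrite !(mul0r, mulr0).
Qed.

Theorem theorem1p2 (p : nat) (p_prime : prime p) (p_mod4 : (p = 1 %[mod 4])%N)
    (n : nat) (n_ge : ((p + 1) %/ 2 <= n)%N) :
  exists a b : int,
    [/\ d (n + (p - 1) %/ 2)%N = a%:~R,
        d n = b%:~R
      & (a = - 2 ^+ ((p - 1) %/ 2)%N
             * (\prod_(1 <= i < ((p - 1) %/ 2).+1) (4 * i%:R - 1) ^+ 2) * b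
          %[mod p])%Z].
Proof.
have -> : ((p - 1) %/ 2 = p./2)%N by lia.
rewrite -/(sqprod 1 _).
exists (numq (d (n + p./2))), (numq (d n)); split; rewrite ?numqK ?d_int //.
have pR := pchar_Fp p_prime.
have two_neq0 : 2 != 0 :> 'F_p.
  rewrite -(dvdn_pcharf pR) gtnNdvd //.
  by move: p_prime p_mod4; case: (p) => [|[|[|]]].
pose A i : 'F_p := (evens (sqprod 3) i)%:~R.
pose U i : 'F_p := (odds u i)%:~R.
(* [F] is V. The powers of 2, invertible modulo p, absorb the 2^n in [hmul_v_sqprod] and the 2^(n-k)
   in the expansion of [v]. *)
pose F : nat -> 'F_p := evens (fun k => (numq (v k))%:~R / 2 ^+ k).
pose e : nat -> 'F_p := evens (fun k => (numq (d k))%:~R / 2 ^+ k).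
pose b : 'F_p := (sqprod 1 p./2)%:~R.
have odd_p : odd p by lia.
have A0 : A 0%N = 1 by rewrite /A /evens /sqprod /= big_geq.
have Ap i : A (i + p)%N = 0.
  rewrite /A /evens oddD odd_p addbT; case: ifP => // odd_i.
  by rewrite (sqprod3_pchar _ _ _ pR) //; lia.
have UA i : hmul U A (i + p) = b * A i.
  rewrite (hmul_rmorph _ _ (intmul (1 : 'F_p))) hmul_u_sqprod /=.
  rewrite /A /odds /evens oddD odd_p addbT; case: ifPn => odd_i; last first.
    by rewrite (negbNE odd_i) mulr0.
  rewrite (negPf odd_i) -(sqprod_shift_pchar _ _ _ pR) //.
  by congr (sqprod _ _)%:~R; lia.
(* Since A^(p) = 0, applying the p-fold shift to U A gives U^(p) A = b A; then A cancels. *)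
have Up i : U (i + p)%N = b * (i == 0)%:R.
  apply/eqP; rewrite -subr_eq0 -mulNr; apply/eqP; move: i.
  apply: (hmul_unitl_eq0 _ _ _ A0) => i.
  rewrite hmulDr hmulZr [X in - b * X]hmulC hmul1f mulNr -UA.
  rewrite hmul_shift_pchar //.
  by rewrite (eq_hmulr _ U _ _ _ Ap) hmulf0 addr0 hmulC subrr.
have FF i : hmul F F i = A i.
  rewrite hmul_evens /A /evens; case: ifPn => // even_i.
  have := hmul_v_sqprod i; rewrite hmul_evens /evens (negPf even_i).
  move: i./2 => {i even_i} m /(congr1 (intmul (1 : 'F_p))).
  rewrite [in X in _ = X -> _]rmorphM rmorphXn rmorph_nat /= mulrC.
  move=> /esym /(canRL (mulfK (expf_neq0 m two_neq0))) ->.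
  rewrite rmorph_sum mulr_suml; apply: eq_bigr => j _.
  rewrite rmorphMn [in RHS]rmorphM /= mulrnAl mulrACA -invfM -exprD subnKC //.
  by rewrite -ltnS.
(* The p-fold shift of F^2 = A reads 2 F F^(p) = 0; both 2 and F cancel. *)
have Fp i : F (i + p)%N = 0.
  move: i; apply: (hmul_unitl_eq0 _ F) => [|i].
    by rewrite /F /evens /= v0 divr1.
  have := FF (i + p)%N; rewrite Ap hmul_shift_pchar // hmulC -mulr2n.
  by move/eqP; rewrite -mulr_natr mulf_eq0 (negPf two_neq0) orbF => /eqP.
(* At odd indices both sides vanish by parity; at even ones this is [numq_vE_sum] divided by a power
   of 2. *)
have FE i : F i = \sum_(m < i.+1) e m * dpow U m i.
  rewrite -[i]odd_double_half; move: i./2 (odd i) => m [].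
    rewrite add1n [LHS]evens_doubleS big1 // => j _.
    rewrite /e /evens; case: ifPn => [_|odd_j]; first by rewrite mul0r.
    rewrite dpow_parity ?mulr0 // => [k|].
      by rewrite /U /odds => /negPf ->.
    by rewrite addnS /= oddD (negPf odd_j) odd_double.
  rewrite add0n [LHS]evens_double.
  rewrite (sum_ord_doubleS _ (fun j => e j * dpow U j m.*2)).
  rewrite [X in _ + X]big1 => [|j _]; last by rewrite /e evens_doubleS mul0r.
  rewrite addr0 numq_vE_sum rmorph_sum mulr_suml; apply: eq_bigr => j _.
  rewrite /e evens_double (dpow_rmorph _ _ (intmul (1 : 'F_p))).
  rewrite [in LHS]rmorphM [in LHS]rmorphM rmorphXn rmorph_nat /=.
  have le_jm : (j <= m)%N by rewrite -ltnS.
  rewrite -[in 2 ^+ m](subnKC le_jm) exprD.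
  by field; rewrite !expf_neq0.
have U0 : U 0%N = 0 by [].
have U1 : U 1%N = 1 by [].
(* The index 2n-1 relates [e] at 2n to [e] at 2n-1+p = 2(n+(p-1)/2). Clearing the denominators of
   [e] then leaves the factor 2^((p-1)/2). *)
have := dpow_sum_shift_pchar _ p U e F b pR U0 U1 Up FE Fp n.*2.-1.
have -> : (n.*2.-1 + p = (n + p./2).*2)%N by lia.
rewrite prednK /e ?evens_double; last by lia.
move/(canRL (divfK (expf_neq0 _ two_neq0))) => dE_shift.
apply/eqP; rewrite eqz_mod_dvd (dvdz_pcharf pR) rmorphB subr_eq0 /= dE_shift.
rewrite [in X in _ == X]rmorphM [in X in _ == X]rmorphM rmorphN.
rewrite rmorphXn rmorph_nat /=.
rewrite -/b addnC exprD.
by apply/eqP; field; rewrite expf_neq0.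
Qed.
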